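(* Let $X$ be a metric space and let $\mu$ be a $\sigma$-finite positive regular Borel measure on $X$. Then there exists a bounded continuous function $f : X \to \mathbb{R}$ that is one-to-one almost everywhere, i.e. there is a subset $E \subset X$ with $\mu(E)=0$ such that the restriction of $f$ to $X \setminus E$ is one-to-one.
   Context: A map $F$ defined on a measure space $X$ is called one-to-one almost everywhere if there is a subset $E$ of $X$ of measure zero such that the restriction of $F$ to $X\setminus E$ is one-to-one (injective). A positive Borel measure $\mu$ on $X$ (with values in $[0,\infty]$) is regular if for every Borel set $E\subset X$ one has both $\mu(E)=\sup\{\mu(K): K\subset E,\ K \text{ compact}\}$ and $\mu(E)=\inf\{\mu(U): U\supset E,\ U\text{ open}\}$. *)

(* Defs.v *)
From HB Require Import structures.
From mathcomp Require Import all_boot all_order all_algebra.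
From mathcomp Require Import all_classical all_reals all_analysis.

Set Implicit Arguments.
Unset Strict Implicit.
Unset Printing Implicit Defensive.

Import Order.TTheory GRing.Theory Num.Theory.
Import numFieldNormedType.Exports.

Local Open Scope classical_set_scope.
Local Open Scope ring_scope.
Local Open Scope ereal_scope.

(* The library endows only pointed types with sigma-algebras, so a metric space
   carrying a measure needs a distinguished point; its choice plays no role. *)
#[short(type="pmetricType")]
HB.structure Definition PointedMetric (K : numDomainType) :=
  {M of Metric K M & isPointed M}.

Notation borel X := (g_sigma_algebraType (@open X)).

Definition regular_measure (R : realType) (X : ptopologicalType)
    (mu : set (borel X) -> \bar R) : Prop :=
  forall E : set (borel X), measurable E ->
    mu E = ereal_sup [set mu K | K in [set K : set X | compact K /\ K `<=` E]] /\
    mu E = ereal_inf [set mu U | U in [set U : set X | open U /\ E `<=` U]].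

Definition one_to_one_ae d (T : measurableType d) (R : realType) (rT : Type)
    (mu : set T -> \bar R) (f : T -> rT) : Prop :=
  exists E : set T, [/\ measurable E, mu E = 0 & set_inj (~` E) f].

(* Main.v *)
Require Import Defs.
From HB Require Import structures.
From mathcomp Require Import all_boot all_order all_algebra.
From mathcomp Require Import all_classical all_reals all_analysis.
From mathcomp Require Import lra.

Set Implicit Arguments.
Unset Strict Implicit.
Unset Printing Implicit Defensive.

Import Order.TTheory GRing.Theory Num.Theory.
Import numFieldNormedType.Exports.

Local Open Scope classical_set_scope.
Local Open Scope ring_scope.

(** Fix compact sets of finite measure that cover [X] up to a null set; they
    exist by sigma-finiteness and inner regularity.  Finite nets of these
    compact sets yield countably many continuous functions [h], namely distances
    to net points minus radii, such that any two distinct points [x], [y] of the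
    union satisfy [h x <= 0 < h y] for one of them
    ([countable_separating_family]).

    The map [f] is a uniform limit of continuous functions [f_ n], each step
    taking care of one function [h] at scale [e = 16^-n].  The values of [f_ n]
    are rounded to multiples of [e] by a continuous staircase, and [e / 2] times
    a continuous approximation of the indicator of [h > 0] is added
    ([separating_perturbation]).  The rounding and the indicator fail to be
    exact only on bands [0 < k < d], for finitely many continuous [k]; as [d]
    tends to 0 these decrease to the empty set, so their measure inside a set of
    finite measure can be made as small as desired.  Outside the bands, two
    points lying on different sides of [h] get values that differ by an odd
    multiple of [e / 2].  The total change made by all later steps is too small
    to close a gap of [e / 2].

    Every [h] is treated infinitely often.  By the Borel-Cantelli lemma almost
    every point lies in finitely many bands only, so for distinct [x] and [y],
    both outside one null set, some late step separates them for good
    ([ae_injective_of_separating_family]). *)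

(** * Ramps and staircases on the real line *)

Section Ramp.
Context (R : realType).
Implicit Types d u t : R.

Definition ramp d u : R := Num.min 1 (Num.max 0 (u / d)).

Lemma ramp_ge0 d u : 0 <= ramp d u.
Proof. by rewrite /ramp le_min ler01 le_max lexx. Qed.

Lemma ramp_le1 d u : ramp d u <= 1.
Proof. by rewrite /ramp ge_min lexx. Qed.

Lemma ramp_eq0 d u : 0 < d -> u <= 0 -> ramp d u = 0.
Proof.
move=> d0 u0; rewrite /ramp (max_idPl _) ?(min_idPr _) ?ler01//.
by rewrite pmulr_lle0 ?invr_gt0.
Qed.

Lemma ramp_eq1 d u : 0 < d -> d <= u -> ramp d u = 1.
Proof.
move=> d0 du; have ud1 : 1 <= u / d by rewrite ler_pdivlMr ?mul1r.
by rewrite /ramp (min_idPl _)// le_max ud1 orbT.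
Qed.

Lemma ramp_ge d u : 0 < d <= 1 -> 0 <= u <= 1 -> u <= ramp d u.
Proof.
move=> /andP[d0 d1] /andP[u0 u1]; rewrite /ramp le_min u1 le_max.
by rewrite ler_pdivlMr// ler_piMr// orbT.
Qed.

Lemma continuous_ramp d : continuous (ramp d).
Proof.
move=> u; apply: (@continuous_min R R (cst 1) (fun u => Num.max 0 (u / d))).
  exact: cvg_cst.
apply: (@continuous_max R R (cst 0) (fun u => u / d)); first exact: cvg_cst.
exact: mulrr_continuous.
Qed.

(** A continuous variant of the ceiling of [t], for [t] in [[0, J]], which
    agrees with it unless [0 < t - j < d] for some natural [j < J]. *)
Definition staircase d J t : R := \sum_(j < J) ramp d (t - j%:R).

(** Induction on [J] works once the bound is split into estimates valid for all
    [t >= 0]: the partial sum stays between [min t J] and [min (t + 1) J].  The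
    only active step is [J <= t <= J + 1], where a ramp of width at most 1 lies
    above the identity. *)
Lemma staircase_near d J t : 0 < d <= 1 -> 0 <= t <= J%:R ->
  `|staircase d J t - t| <= 1.
Proof.
move=> d01 /andP[t0 tJ]; have d0 : 0 < d by case/andP: d01.
suff : [/\ t <= J%:R -> t <= staircase d J t,
           J%:R <= t -> J%:R <= staircase d J t,
           staircase d J t <= J%:R & staircase d J t <= t + 1].
  by move=> [/(_ tJ) + _ _]; rewrite ler_norml; lra.
rewrite /staircase; elim: J {tJ} => [|J [IH1 IH2 IH3 IH4]].
  rewrite big_ord0; split; lra.
rewrite big_ord_recr/=; set S := \sum_(_ < _) _ in IH1 IH2 IH3 IH4 *.
rewrite -natr1; have [tJ|Jt] := leP t J%:R.
  rewrite ramp_eq0//; last by lra.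
  have := IH1 tJ.
  split; lra.
have r1 := ramp_le1 d (t - J%:R).
have IH := IH2 (ltW Jt).
have [tJ1|Jt1] := leP t (J%:R + 1).
  have rt : t - J%:R <= ramp d (t - J%:R) by apply: ramp_ge => //; lra.
  split; lra.
have -> : ramp d (t - J%:R) = 1 by apply: ramp_eq1 => //; lra.
split; lra.
Qed.

Lemma staircase_nat d J t : 0 < d ->
  (forall j, (j < J)%N -> ~ (0 < t - j%:R < d)) ->
  exists a : nat, staircase d J t = a%:R.
Proof.
rewrite /staircase => d0; elim: J => [|J IH] H.
  by exists 0%N; rewrite big_ord0.
have [j jJ|a aE] := IH; first by apply: H; rewrite ltnS ltnW.
rewrite big_ord_recr/= aE.
have [tJ|Jt] := leP (t - J%:R) 0.
  by exists a; rewrite ramp_eq0// addr0.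
exists a.+1; rewrite ramp_eq1 ?natr1// leNgt.
by apply/negP => tJd; apply: (H J) => //; rewrite Jt.
Qed.

Lemma continuous_staircase d J : continuous (staircase d J).
Proof.
rewrite /staircase => t; apply: cvg_big => [|j _]; first exact: add_continuous.
apply: (@continuous_comp _ _ _ (fun t => t - j%:R) (ramp d)).
  by apply: continuousB; [exact: cvg_id | exact: cvg_cst].
exact: continuous_ramp.
Qed.

End Ramp.

(** * Separating two sides of a function by a small perturbation *)

Lemma measurable_open (X : ptopologicalType) (U : set X) :
  open U -> measurable (U : set (borel X)).
Proof. exact: sub_sigma_algebra. Qed.

Lemma measurable_compact (X : ptopologicalType) (K : set X) :
  hausdorff_space X -> compact K -> measurable (K : set (borel X)).
Proof.
move=> hX cK; rewrite -(setCK (K : set (borel X))); apply: measurableC.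
by apply: measurable_open; apply: closed_openC; exact: compact_closed.
Qed.

Section Perturb.
Context (R : realType) (X : ptopologicalType).
Context (mu : {measure set (borel X) -> \bar R}).
Implicit Types (F : set (borel X)) (f h : X -> R).

(** The points where, among [H 0, ..., H J.-1], some ramp of width [d] takes a
    value other than 0 and 1. *)
Definition band (H : nat -> X -> R) (J : nat) (d : R) : set X :=
  [set x | exists2 j, (j < J)%N & 0 < H j x < d].

Lemma open_band (H : nat -> X -> R) J d :
  (forall j, continuous (H j)) -> open (band H J d).
Proof.
move=> cH.
have -> : band H J d = \bigcup_(j in `I_J) (H j @^-1` [set` `]0, d[]).
  apply/seteqP; split=> x [j jJ].
    by move=> hx; exists j => //=; rewrite in_itv.
  by rewrite /= in_itv => hx; exists j.
apply: bigcup_open => j _; apply: open_comp; last exact: itv_open.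
by move=> x _; exact: cH.
Qed.

Lemma band_vanish (H : nat -> X -> R) J x :
  exists2 d : R, 0 < d & ~ band H J d x.
Proof.
elim: J => [|J [d d0 dx]]; first by exists 1 => // -[].
exists (if 0 < H J x then Num.min d (H J x) else d).
  by case: ifPn => // HJ; rewrite lt_min d0.
move=> [j]; rewrite ltnS leq_eqVlt => /predU1P[->|jJ] /andP[Hj0 Hjd].
  by move: Hjd; rewrite Hj0 lt_min ltxx andbF.
apply: dx; exists j => //; rewrite Hj0/=.
by move: Hjd; case: ifPn => // _; rewrite lt_min => /andP[].
Qed.

(** Because the bands are open at both ends, they decrease to the empty set as
    [d] tends to 0, whatever the levels; continuity from above of the finite
    measure [mu] restricted to [F] concludes. *)
Lemma thin_band F (H : nat -> X -> R) J (eta : R) :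
  measurable F -> (mu F < +oo)%E -> (forall j, continuous (H j)) -> 0 < eta ->
  exists2 d : R, 0 < d <= 1 & (mu (band H J d `&` F) <= eta%:E)%E.
Proof.
move=> mF Foo cH eta0.
pose A n : set (borel X) := band H J n.+1%:R^-1 `&` F.
have mA n : measurable (A n).
  by apply: measurableI => //; apply: measurable_open; exact: open_band.
have : mu \o A @ \oo --> mu (\bigcap_n A n).
  apply: nonincreasing_cvg_mu => //; last 2 first.
  - exact: bigcapT_measurable.
  - move=> m n mn; apply/subsetPset => x [[j jJ /andP[Hj0 Hjm]] Fx]; split => //.
    exists j => //; rewrite Hj0/= (lt_le_trans Hjm)//.
    by rewrite lef_pV2 ?posrE// ler_nat.
  by apply: le_lt_trans Foo; apply: le_measure; rewrite ?inE//; exact: subIsetr.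
have -> : \bigcap_n A n = set0.
  rewrite -subset0 => x Ax; have [d d0 ndx] := band_vanish H J x.
  have [n _ /(_ _ (leqnn n))] := near_infty_natSinv_lt (PosNum d0).
  move=> /= nd; apply: ndx; have [[j jJ /andP[Hj0 Hjn]] _] := Ax n I.
  by exists j => //; rewrite Hj0 (lt_trans Hjn).
rewrite measure0 => muA0.
have [|n _ /(_ _ (leqnn n))/= An] := muA0 [set y | (y < eta%:E)%E].
  by apply: open_ereal_lt'; rewrite lte_fin.
exists n.+1%:R^-1; last exact: ltW.
by rewrite invr_gt0 ltr0n invf_le1// ler1n ltnS leq0n.
Qed.

(** With [f] rescaled by [e], the new function is [e * (c + r / 2)], where [c]
    is integral and [r] is 0 or 1 outside the bands.  Across [h] the values of
    [r] are 0 and 1, so the values of [c + r / 2] differ by at least [1 / 2] however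
    the values of [c] compare. *)
Lemma separating_perturbation F f h (e eta : R) :
  measurable F -> (mu F < +oo)%E -> continuous f -> bounded_fun f ->
  continuous h -> 0 < e -> 0 < eta ->
  exists (g : X -> R) (B : set (borel X)),
    [/\ continuous g /\ bounded_fun g, forall x, `|g x - f x| <= 2 * e,
        measurable B, (mu (B `&` F) <= eta%:E)%E &
        forall x y, ~ B x -> ~ B y -> h x <= 0 -> 0 < h y ->
          e / 2 <= `|g x - g y|].
Proof.
move=> mF Foo cf [M [_ fM]] ch e0 eta0.
have {}fM x : `|f x| <= `|M| + 1.
  by apply: fM => //; have := ler_norm M; lra.
have [J MJ] : exists J : nat, (`|M| + 1) / e <= J%:R.
  by exists (Num.truncn ((`|M| + 1) / e)).+1; apply/ltW/truncnS_gt.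
(* The shift by [J] makes the rescaled function take its values in [[0, 2J]]. *)
pose u x := f x / e + J%:R.
have u0J x : 0 <= u x <= J.*2%:R.
  have : `|f x / e| <= J%:R.
    rewrite normrM (gtr0_norm (x := e^-1)) ?invr_gt0//.
    by rewrite (le_trans _ MJ)// ler_pM2r ?invr_gt0.
  by rewrite /u -addnn natrD ler_norml; lra.
have cu : continuous u.
  move=> x; apply: cvgD; last exact: cvg_cst.
  by apply: cvgM; [exact: cf | exact: cvg_cst].
(* The levels of the staircase, followed by [h] itself at index [2J]. *)
pose H j x := if (j < J.*2)%N then u x - j%:R else h x.
have cH j : continuous (H j).
  rewrite /H; case: (j < J.*2)%N => // x.
  by apply: cvgB; [exact: cu | exact: cvg_cst].
have [d d01 muB] := thin_band J.*2.+1 mF Foo cH eta0.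
have d0 : 0 < d by case/andP: d01.
pose v x := staircase d J.*2 (u x) - J%:R + ramp d (h x) / 2.
have cv : continuous v.
  move=> x; apply: cvgD.
    apply: cvgB; last exact: cvg_cst.
    apply: (@continuous_comp _ _ _ u); first exact: cu.
    exact: continuous_staircase.
  apply: cvgM; last exact: cvg_cst.
  by apply: (@continuous_comp _ _ _ h); [exact: ch | exact: continuous_ramp].
have vf x : `|e * v x - f x| <= 2 * e.
  have -> : e * v x - f x = e * (v x - f x / e).
    by rewrite mulrBr mulrCA divff ?mulr1// gt_eqF.
  rewrite normrM gtr0_norm// [leRHS]mulrC ler_pM2l//.
  have := staircase_near d01 (u0J x); have := ramp_ge0 d (h x).
  by have := ramp_le1 d (h x); rewrite /v /u !ler_norml; lra.
exists (fun x => e * v x), (band H J.*2.+1 d); split => //.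
- split; first by move=> x; apply: cvgM; [exact: cvg_cst | exact: cv].
  exists (`|M| + 1 + 2 * e); split; first exact: num_real.
  move=> m Mm x _ /=; apply: le_trans (ltW Mm).
  have := vf x; have := fM x; move: (`|M| + 1) => ?.
  by rewrite !ler_norml; lra.
- by apply: measurable_open; exact: open_band.
move=> x y Bx By hx hy.
have good z : ~ band H J.*2.+1 d z ->
    exists a : nat, staircase d J.*2 (u z) = a%:R.
  move=> Bz; apply: staircase_nat => // j jJ Hj; apply: Bz.
  by exists j; [rewrite ltnS ltnW | rewrite /H jJ].
have [a ax] := good x Bx; have [b b_y] := good y By.
have hyd : d <= h y.
  rewrite leNgt; apply/negP => hyd; apply: By.
  by exists J.*2; rewrite ?ltnSn// /H ltnn hy.
rewrite -mulrBr normrM gtr0_norm// ler_pM2l//.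
rewrite /v ax b_y (ramp_eq0 d0 hx) (ramp_eq1 d0 hyd) ler_normr.
apply/orP; have [ab|ba] := leqP a b.
  by right; have : (a%:R : R) <= b%:R by [rewrite ler_nat]; lra.
by left; have : (b.+1%:R : R) <= a%:R by [rewrite ler_nat]; rewrite -natr1; lra.
Qed.

End Perturb.

(** * Almost everywhere injectivity from a countable separating family *)

(** Each code [pickle i] is the 2-adic valuation of infinitely many numbers. *)
Lemma infinitely_often_enum (I : countType) (i0 : I) :
  exists s : nat -> I, forall i N, exists2 n, (N <= n)%N & s n = i.
Proof.
exists (fun n => odflt i0 (unpickle (logn 2 n))) => i N.
exists (2 ^ pickle i * (N.*2).+1)%N.
  rewrite (leq_trans _ (leq_pmull _ _)) ?expn_gt0//.
  by rewrite leqW// -addnn leq_addr.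
rewrite lognM ?expn_gt0// pfactorK// logn_coprime ?addn0 ?pickleK//.
by rewrite coprime2n /= odd_double.
Qed.

Section Core.
Context (R : realType) (X : ptopologicalType).
Context (mu : {measure set (borel X) -> \bar R}).

Lemma lim_sup_set_geometric (A : nat -> set (borel X)) :
  (forall n, measurable (A n)) ->
  (forall n, (mu (A n) <= (1 / (2 ^ n.+1)%:R)%:E)%E) ->
  mu (lim_sup_set A) = 0%E.
Proof.
move=> mA muA; apply: lim_sup_set_cvg0 => //.
apply: (@le_lt_trans _ _ 1%E); last by rewrite ltry.
by apply: le_trans (epsilon_trick0 xpredT ler01); apply: lee_nneseries.
Qed.

(** The factor 3 exceeds [2 / (1 - 16^-1)], which makes the intervals of centre
    [a n] and radius [3 * 16^-n] nested; the limit is their common point. *)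
Lemma geometric_limit (a : nat -> R) :
  (forall n, `|a n.+1 - a n| <= 2 * 16^-1 ^+ n) ->
  exists l, forall n, `|l - a n| <= 3 * 16^-1 ^+ n.
Proof.
move=> da; pose e n : R := 16^-1 ^+ n.
have eS n : e n.+1 = 16^-1 * e n by rewrite /e exprS.
have e0 n : 0 < e n by rewrite exprn_gt0// invr_gt0.
have up n k : a n - 3 * e n <= a (n + k)%N - 3 * e (n + k)%N.
  elim: k => [|k IH]; first by rewrite addn0.
  apply: le_trans IH _; rewrite addnS eS.
  by have := da (n + k)%N; have := e0 (n + k)%N; rewrite -/(e _) ler_norml; lra.
have dn n k : a (n + k)%N + 3 * e (n + k)%N <= a n + 3 * e n.
  elim: k => [|k IH]; first by rewrite addn0.
  apply: le_trans IH; rewrite addnS eS.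
  by have := da (n + k)%N; have := e0 (n + k)%N; rewrite -/(e _) ler_norml; lra.
have ub n m : a m - 3 * e m <= a n + 3 * e n.
  have [mn|/ltnW nm] := leqP m n.
    by have := up m (n - m)%N; rewrite subnKC//; have := e0 n; lra.
  by have := dn n (m - n)%N; rewrite subnKC//; have := e0 m; lra.
pose A := range (fun m => a m - 3 * e m).
exists (sup A) => n; rewrite -/(e n) ler_distl; apply/andP; split.
  apply: ub_le_sup; last by exists n.
  by exists (a 0%N + 3 * e 0%N) => _ [m _ <-]; exact: ub.
apply: ge_sup; first by exists (a 0%N - 3 * e 0%N); exists 0%N.
by move=> _ [m _ <-]; exact: ub.
Qed.

Lemma uniform_limit (f_ : nat -> X -> R) :
  (forall n, continuous (f_ n)) -> (bounded_fun (f_ 0%N)) ->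
  (forall n x, `|f_ n.+1 x - f_ n x| <= 2 * 16^-1 ^+ n) ->
  exists f : X -> R, [/\ continuous f, bounded_fun f &
    forall n x, `|f x - f_ n x| <= 3 * 16^-1 ^+ n].
Proof.
move=> cf [M [_ f0M]] df.
have [f ff] : {f : X -> R & forall x n, `|f x - f_ n x| <= 3 * 16^-1 ^+ n}.
  apply: (@choice _ _ (fun x l =>
    forall n, `|l - f_ n x| <= 3 * 16^-1 ^+ n)) => x.
  by apply: geometric_limit => n; exact: df.
exists f; split => //.
- move=> x; apply/cvgrPdist_lt => e e0.
  have [n ne] : exists n, 16^-1 ^+ n < e / 9.
    have : 16^-1 ^+ n @[n --> \oo] --> (0 : R).
      by apply: cvg_expr; rewrite ger0_norm//; lra.
    move=> /cvgrPdist_lt /(_ (e / 9)).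
    have -> : 0 < e / 9 by lra.
    move=> /(_ isT)[n _ /(_ _ (leqnn n))/=].
    by rewrite sub0r normrN ger0_norm ?exprn_ge0 ?invr_ge0//; exists n.
  have e30 : 0 < e / 3 by lra.
  move/cvgrPdist_lt : (cf n x) => /(_ _ e30).
  apply: filterS => y /=.
  have := ff x n; have := ff y n; move: (16^-1 ^+ n) ne => ? ?.
  by rewrite !ler_norml !ltr_norml; lra.
- exists (`|M| + 4); split; first exact: num_real.
  move=> m Mm x _ /=; apply: le_trans (ltW Mm).
  have : `|f_ 0%N x| <= `|M| + 1 by apply: f0M => //; have := ler_norm M; lra.
  by have := ff x 0%N; rewrite expr0; move: `|M| => ?; rewrite !ler_norml; lra.
Qed.

(** Let [F n] be the union of [K 0], ..., [K n].  The step [n] separates the two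
    sides of [h (s n)] with a gap [e n / 2], except on a set [B n] of measure at
    most [2^-(n+1)] inside [F n].  Later steps move each value by at most
    [3 * e n.+1 = 3 * e n / 16], hence a difference of two values by at most
    [3 * e n / 8 < e n / 2].  Since [F] is increasing, a point of its union
    outside the limit superior of [B n `&` F n] lies outside [B n] for all large
    [n]. *)
Lemma ae_injective_of_separating_family (I : countType)
    (K : nat -> set (borel X)) (h : I -> X -> R) :
  (forall n, measurable (K n)) -> (forall n, (mu (K n) < +oo)%E) ->
  (mu (~` \bigcup_n K n) = 0)%E ->
  (forall i, continuous (h i)) ->
  (forall x y, (\bigcup_n K n) x -> (\bigcup_n K n) y -> x <> y ->
    exists i, h i x <= 0 < h i y) ->
  exists f : X -> R, [/\ continuous f, bounded_fun f & one_to_one_ae mu f].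
Proof.
move=> mK Koo; rewrite -bigcup_bigsetU_bigcup.
pose F n : set (borel X) := \big[setU/set0]_(i < n.+1) K i.
rewrite -/F => F0 ch hsep.
have mF n : measurable (F n) by exact: bigsetU_measurable.
have ndF : {homo F : m n / (m <= n)%N >-> m `<=` n}.
  by move=> m n mn; exact: subset_bigsetU.
have Foo n : (mu (F n) < +oo)%E.
  apply: le_lt_trans (Boole_inequality mu (fun i _ => mK i)) _.
  by apply/lte_sum_pinfty => i _; exact: Koo.
have [[i0 _]|noI] := pselect (exists i : I, True); last first.
  exists (cst 0); split; [by move=> x; exact: cvg_cst| |].
    exists 0; split; first exact: num_real.
    by move=> M M0 x _; rewrite /= normr0 ltW.
  (* Without any function [h] the union of [F] has at most one point. *)
  exists (~` \bigcup_n F n); split => //.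
    by apply: measurableC; exact: bigcupT_measurable.
  move=> x y; rewrite setCK !inE => Fx Fy _; apply: contrapT => xy.
  by have [i _] := hsep _ _ Fx Fy xy; apply: noI; exists i.
have [s s_io] := infinitely_often_enum i0.
pose e n : R := 16^-1 ^+ n.
have e0 n : 0 < e n by rewrite exprn_gt0// invr_gt0.
pose bc := {f : X -> R | continuous f /\ bounded_fun f}.
pose next (nf : nat * bc) (gB : bc * set (borel X)) :=
  let: (n, f, (g, B)) := (nf, gB) in
  [/\ forall x, `|sval g x - sval f x| <= 2 * e n, measurable B,
     (mu (B `&` F n) <= (1 / (2 ^ n.+1)%:R)%:E)%E &
     forall x y, ~ B x -> ~ B y -> h (s n) x <= 0 -> 0 < h (s n) y ->
       e n / 2 <= `|sval g x - sval g y|].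
have [step stepP] : {step : nat * bc -> bc * set (borel X) &
    forall nf, next nf (step nf)}.
  apply: (@choice _ _ next) => -[n [f [cf bf]]].
  have [|g [B [cbg gf mB muB gB]]] :=
    separating_perturbation (eta := 1 / (2 ^ n.+1)%:R)
      (mF n) (Foo n) cf bf (ch (s n)) (e0 n).
    by rewrite divr_gt0// ltr0n expn_gt0.
  by exists (exist _ g cbg, B).
have bc0 : continuous (cst 0 : X -> R) /\ bounded_fun (cst 0 : X -> R).
  split; first by move=> x; exact: cvg_cst.
  by exists 0; split; [exact: num_real|move=> M M0 x _; rewrite /= normr0 ltW].
pose f_ := nat_rect (fun=> bc) (exist _ _ bc0) (fun n f => (step (n, f)).1).
pose B n := (step (n, f_ n)).2.
have fB n : next (n, f_ n) (f_ n.+1, B n).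
  by have := stepP (n, f_ n); rewrite /B /=; case: (step _).
have [||n x|f [cf bf ff]] := uniform_limit (f_ := fun n => sval (f_ n)).
- by move=> n; have [] := svalP (f_ n).
- by have [] := svalP (f_ 0%N).
- by have [] := fB n.
have mBF n : measurable (B n `&` F n).
  by apply: measurableI => //; have [] := fB n.
have mUF : measurable (\bigcup_n F n) by exact: bigcupT_measurable.
have mlim : measurable (lim_sup_set (fun n => B n `&` F n)).
  by apply: bigcap_measurable => // m _; exact: bigcup_measurable.
have limB0 : mu (lim_sup_set (fun n => B n `&` F n)) = 0%E.
  by apply: lim_sup_set_geometric => // n; have [] := fB n.
exists f; split => //.
exists (~` (\bigcup_n F n) `|` lim_sup_set (fun n => B n `&` F n)); split.
- by apply: measurableU; [exact: measurableC | exact: mlim].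
- by rewrite measureU0//; exact: measurableC.
move=> x y; rewrite setCU setCK !inE => -[Fx Bx] [Fy By] fxy.
apply: contrapT => xy.
have good z : (\bigcup_n F n) z -> ~ lim_sup_set (fun n => B n `&` F n) z ->
    exists N, forall n, (N <= n)%N -> ~ B n z.
  move=> [k _ Fkz] /existsNP[m] /not_implyP[_ nBm].
  exists (maxn k m) => n; rewrite geq_max => /andP[kn mn] Bnz.
  by apply: nBm; exists n => //; split => //; exact: ndF Fkz.
have [N Nx] := good _ Fx Bx; have [M My] := good _ Fy By.
have [i /andP[hx hy]] := hsep _ _ Fx Fy xy.
have [n + sn] := s_io i (maxn N M); rewrite geq_max => /andP[Nn Mn].
have [_ _ _ /(_ x y (Nx _ Nn) (My _ Mn))] := fB n.
rewrite sn => /(_ hx hy) sep.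
have := ff n.+1 x; have := ff n.+1 y; rewrite exprS -/(e n) fxy.
have := e0 n; move: sep.
move: (e n) (sval (f_ n.+1) x) (sval (f_ n.+1) y) => r a b.
have [ab|ab] := leP 0 (a - b); [rewrite ger0_norm//|rewrite ltr0_norm//];
  by rewrite !ler_norml; lra.
Qed.
End Core.

(** * Compact sets in metric spaces with a regular measure *)

Section Metric.
Context (R : realType) (X : pmetricType R).

Lemma continuous_mdist (p : X) : continuous (mdist p : X -> R).
Proof.
move=> x; apply/cvgrPdist_lt => e e0.
apply: filterS (nbhsx_ballx x e e0) => y; rewrite ballEmdist/= => xye.
have := metric_triangle p x y; have := metric_triangle p y x.
by rewrite (metric_sym y x) ltr_norml; lra.
Qed.

Lemma compact_net (K : set X) (r : R) : compact K -> 0 < r ->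
  exists s : seq X, forall x, K x -> exists2 p, p \in s & mdist p x < r.
Proof.
rewrite compact_cover => cK r0.
have [p _|x Kx|D _ KD] := cK X setT (fun p => [set x | mdist p x < r]).
- apply: (@open_comp _ _ (mdist p) [set t | t < r]); last exact: open_lt.
  by move=> x _; exact: continuous_mdist.
- by exists x => //=; rewrite mdistxx.
by exists (finmap.enum_fset D) => x /KD[p pD]; exists p.
Qed.

(** Let [r = 1 / (m + 1)] be less than half the distance of [x] and [y].  If [p]
    belongs to an [r]-net of [K n] and is [r]-close to [x], then [mdist p - r] is
    negative at [x] and positive at [y].  The index [((n, m), j)] stands for the
    [j]-th point of this net. *)
Lemma countable_separating_family (K : nat -> set X) :
  (forall n, compact (K n)) ->
  exists h : nat * nat * nat -> X -> R, (forall i, continuous (h i)) /\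
    forall x y, (\bigcup_n K n) x -> x <> y -> exists i, h i x <= 0 < h i y.
Proof.
move=> cK.
have [s sP] : {s : nat * nat -> seq X & forall i x, K i.1 x ->
    exists2 p, p \in s i & mdist p x < i.2.+1%:R^-1}.
  apply: (@choice _ _ (fun i s => forall x, K i.1 x ->
    exists2 p, p \in s & mdist p x < i.2.+1%:R^-1)) => i.
  by apply: compact_net => //; rewrite invr_gt0.
exists (fun i x => mdist (nth point (s i.1) i.2) x - i.1.2.+1%:R^-1); split.
  by move=> i x; apply: cvgB; [exact: continuous_mdist | exact: cvg_cst].
move=> x y [n _ Kx] /eqP xy'.
have xy : 0 < mdist x y by rewrite mdist_gt0.
have xy2 : 0 < mdist x y / 2 by rewrite divr_gt0.
have [m _ /(_ _ (leqnn m))/= mxy] := near_infty_natSinv_lt (PosNum xy2).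
have [p ps px] := sP (n, m) x Kx.
exists ((n, m), index p (s (n, m))); rewrite /= nth_index//.
have tri : mdist x y <= mdist p x + mdist p y.
  by rewrite (metric_sym p x); exact: metric_triangle.
move: px tri mxy => /=; move: (m.+1%:R^-1) => r px tri mxy.
by apply/andP; split; lra.
Qed.

End Metric.

(** Inner regularity fills each set of a sigma-finite cover, up to measure
    [1/(m+1)], by a compact set; the union over [m] then leaves a null set. *)
Lemma compact_exhaustion (R : realType) (X : ptopologicalType)
    (mu : {measure set (borel X) -> \bar R}) :
  hausdorff_space X -> sigma_finite [set: borel X] mu -> regular_measure mu ->
  exists K : nat -> set X, [/\ forall n, compact (K n),
    forall n, (mu (K n) < +oo)%E & mu (~` \bigcup_n K n) = 0%E].
Proof.
move=> hX [F F_cover Ffin] reg.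
have mF k : measurable (F k) by have [] := Ffin k.
have Foo k : (mu (F k) < +oo)%E by have [] := Ffin k.
have mcompact := measurable_compact hX.
have [C CP] : {C : nat * nat -> set X & forall i,
    [/\ compact (C i), C i `<=` F i.1 &
      (mu (F i.1 `\` C i) <= (i.2.+1%:R^-1)%:E)%E]}.
  apply: (@choice _ _ (fun i C => [/\ compact C, C `<=` F i.1 &
    (mu (F i.1 `\` C) <= (i.2.+1%:R^-1)%:E)%E])) => -[k m] /=.
  have [muF _] := reg _ (mF k).
  have finF : mu (F k) \is a fin_num by rewrite ge0_fin_numE.
  have m0 : 0 < (m.+1%:R^-1 : R) by rewrite invr_gt0.
  move: (finF); rewrite muF => /(ub_ereal_sup_adherent m0)[_ [C [cC CF] <-]].
  rewrite -muF => FC.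
  exists C; split => //.
  have mC : measurable (C : set (borel X)) by exact: mcompact.
  rewrite measureD; [|exact: mF|exact: mC|exact: Foo].
  rewrite setIidr//.
  have finC : mu C \is a fin_num.
    rewrite ge0_fin_numE//; apply: le_lt_trans (Foo k).
    by apply: le_measure; rewrite ?inE.
  by rewrite leeBlDr// addeC -leeBlDr//; exact: ltW.
have mC i : measurable (C i : set (borel X)).
  by apply: mcompact; have [] := CP i.
pose K n := if unpickle n is Some i then C i else set0.
have KC : \bigcup_n K n = \bigcup_i C i.
  apply/seteqP; split=> x [n _]; rewrite /K.
    by case: unpickle => [i|//] Cx; exists i.
  by move=> Cx; exists (pickle n) => //; rewrite pickleK.
exists K; split.
- move=> n; rewrite /K; case: unpickle => [i|]; last exact: compact0.
  by have [] := CP i.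
- move=> n; rewrite /K; case: unpickle => [i|]; last by rewrite measure0.
  have [_ CF _] := CP i.
  by apply: le_lt_trans (Foo i.1); apply: le_measure; rewrite ?inE//.
have mUC : measurable (\bigcup_i C i : set (borel X)).
  rewrite -KC; apply: bigcupT_measurable => n; rewrite /K.
  by case: unpickle => [i|]; [exact: mC | exact: measurable0].
rewrite KC; apply/negligibleP; first exact: measurableC.
have -> : ~` (\bigcup_i C i) = \bigcup_k (F k `\` \bigcup_i C i).
  by rewrite -setD_bigcupl -F_cover setTD.
apply: negligible_bigcup => k; apply/negligibleP; first exact: measurableD.
apply/eqP; rewrite eq_le measure_ge0 andbT; apply/lee_addgt0Pr => e e0.
have [m _ /(_ _ (leqnn m))/= me] := near_infty_natSinv_lt (PosNum e0).
rewrite add0e (@le_trans _ _ (m.+1%:R^-1)%:E)//; last by rewrite lee_fin ltW.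
have [_ _ +] := CP (k, m); apply: le_trans; apply: le_measure; rewrite ?inE.
- exact: measurableD.
- by apply: measurableD.
- by apply: setDS => x Cx; exists (k, m).
Qed.

Theorem theorem1p2 (R : realType) (X : pmetricType R)
    (mu : {measure set (borel X) -> \bar R}) :
  sigma_finite [set: borel X] mu ->
  regular_measure mu ->
  exists f : X -> R,
    [/\ continuous f, bounded_fun f & one_to_one_ae mu f].
Proof.
move=> sf reg.
have hX : hausdorff_space X by exact: metric_hausdorff.
have [K [cK Koo K0]] := compact_exhaustion hX sf reg.
have [h [ch hsep]] := countable_separating_family cK.
apply: (ae_injective_of_separating_family _ Koo K0 ch) => [n|x y Kx _].
  exact: measurable_compact.
exact: hsep.
Qed.
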